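(* Let $n$ be a positive integer. If $R$ is a semiprime ring, then $MC_n(R)$ is a semiprime ring.
   Context: All rings are associative with $1$. A ring $R$ is semiprime if its zero ideal is semiprime, i.e. for $a\in R$, if $axa=0$ for all $x\in R$ then $a=0$. $M_m(R)$ is the ring of $m\times m$ matrices over $R$. Identify $M_n(M_{n^k}(R))$ with $M_{n^{k+1}}(R)$ via block matrices. The $n$-matricial closure $MC_n(R)$ is the direct limit of the rings $M_{n^k}(R)$, $k\in\mathbb{N}=\{0,1,2,\dots\}$ (with $M_{n^0}(R)=R$), along the injective ring morphisms $M_{n^k}(R)\to M_{n^{k+1}}(R)$ sending $A$ to the block diagonal matrix with $n$ diagonal blocks equal to $A$. *)

(* Defs.v *)
(* MathComp, with mathcomp.classical.boolp to decide the equivalence relation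
   of a direct limit.  Rings are pzRingType: associative, with 1, and possibly
   trivial. *)
From HB Require Import structures.
From mathcomp Require Import all_boot all_order all_algebra.
From mathcomp Require Import generic_quotient boolp.

Set Implicit Arguments.
Unset Strict Implicit.
Unset Printing Implicit Defensive.

Import GRing.Theory.
Local Open Scope ring_scope.

Definition semiprime_ring (R : pzRingType) : Prop :=
  forall a : R, (forall x : R, a * x * a = 0) -> a = 0.

Module DirectLimit.
Section DirectLimit.
Local Open Scope nat_scope.
Local Open Scope quotient_scope.
Variables (S : nat -> pzRingType) (f : forall k, {rmorphism S k -> S k.+1}).

Local Notation pre := {k : nat & S k}.
Local Notation mk := (Tagged (fun k => S k)).
Implicit Types u v w : pre.

(* For u = (k, x), this is the image of x under the transition map
   S k -> S m when k <= m, and the irrelevant value 0 when m < k. *)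
Fixpoint push u (m : nat) : S m :=
  match m with
  | 0 => untag (0 : S 0)%R id u
  | m'.+1 => untag (f m' (push u m')) id u
  end.

Lemma push_tag u : push u (tag u) = tagged u.
Proof.
case: u => k x /=; set u := mk x.
by case: k x @u => [|k] x u; rewrite /= (untagE _ _ (erefl : tag u = _)).
Qed.

Lemma pushS u m : tag u <= m -> push u m.+1 = f m (push u m).
Proof. by move=> um /=; rewrite untag_dflt // neq_ltn ltnS um. Qed.

Definition eqv u v : bool :=
  `[< exists2 m, maxn (tag u) (tag v) <= m & push u m = push v m >].

Lemma push_le u v m n : tag u <= m -> tag v <= m -> m <= n ->
  push u m = push v m -> push u n = push v n.
Proof.
move=> um vm /subnK <- e; elim: (n - m)%N => [//|d IH].
have md : m <= d + m by rewrite leq_addl.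
by rewrite addSn !pushS ?IH ?(leq_trans um) ?(leq_trans vm).
Qed.

Lemma eqvP u v :
  reflect (exists N, forall m, N <= m -> push u m = push v m) (eqv u v).
Proof.
apply: (iffP idP) => [/asboolP[m]|[N e]].
  rewrite geq_max => /andP[um vm] e; exists m => n mn.
  exact: push_le um vm mn e.
apply/asboolP; exists (maxn (maxn (tag u) (tag v)) N); first exact: leq_maxl.
by apply: e; exact: leq_maxr.
Qed.

Lemma eqv_refl : reflexive eqv.
Proof. by move=> u; apply/eqvP; exists 0. Qed.

Lemma eqv_sym : symmetric eqv.
Proof. by move=> u v; apply/eqvP/eqvP => -[N e]; exists N => m /e. Qed.

Lemma eqv_trans : transitive eqv.
Proof.
move=> v u w /eqvP[M e1] /eqvP[N e2]; apply/eqvP; exists (maxn M N) => m.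
by rewrite geq_max => /andP[/e1-> /e2->].
Qed.

Canonical eqv_equiv := EquivRel eqv eqv_refl eqv_sym eqv_trans.

Definition type := {eq_quot eqv}.

HB.instance Definition _ : EqQuotient _ eqv type := EqQuotient.on type.
HB.instance Definition _ := Choice.on type.

Lemma piP u v : reflect (exists N, forall m, N <= m -> push u m = push v m)
  (u == v %[mod type]).
Proof. by rewrite eqmodE; exact: eqvP. Qed.

Lemma push_repr u :
  exists N, forall m, N <= m -> push (repr (\pi_type u)) m = push u m.
Proof. by apply/piP; rewrite reprK. Qed.

Definition zerop : pre := mk (0%R : S 0).
Definition onep : pre := mk (1%R : S 0).
Definition oppp u : pre := mk (- tagged u)%R.
Definition addp u v : pre :=
  let m := maxn (tag u) (tag v) in mk (push u m + push v m)%R.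
Definition mulp u v : pre :=
  let m := maxn (tag u) (tag v) in mk (push u m * push v m)%R.

Lemma push0 m : push zerop m = 0%R.
Proof. by elim: m => [|m IH]; rewrite ?(push_tag zerop) // pushS // IH rmorph0. Qed.

Lemma push1 m : push onep m = 1%R.
Proof. by elim: m => [|m IH]; rewrite ?(push_tag onep) // pushS // IH rmorph1. Qed.

Lemma pushN u m : tag u <= m -> push (oppp u) m = (- push u m)%R.
Proof.
move=> /subnK <-; elim: (m - tag u)%N => [|d IH].
  by rewrite add0n (push_tag (oppp u)) push_tag.
by rewrite addSn !pushS ?leq_addl // IH rmorphN.
Qed.

Lemma pushD u v m : maxn (tag u) (tag v) <= m ->
  push (addp u v) m = (push u m + push v m)%R.
Proof.
move=> /subnK <-; elim: (m - _)%N => [|d IH].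
  by rewrite add0n (push_tag (addp u v)).
rewrite addSn !pushS ?IH ?rmorphD ?leq_addl //;
  apply: leq_trans (leq_addl _ _); rewrite ?leq_maxl ?leq_maxr //.
Qed.

Lemma pushM u v m : maxn (tag u) (tag v) <= m ->
  push (mulp u v) m = (push u m * push v m)%R.
Proof.
move=> /subnK <-; elim: (m - _)%N => [|d IH].
  by rewrite add0n (push_tag (mulp u v)).
rewrite addSn !pushS ?IH ?rmorphM ?leq_addl //;
  apply: leq_trans (leq_addl _ _); rewrite ?leq_maxl ?leq_maxr //.
Qed.

Definition zero : type := lift_cst type zerop.
Definition one : type := lift_cst type onep.
Definition opp := lift_op1 type oppp.
Definition add := lift_op2 type addp.
Definition mul := lift_op2 type mulp.

Canonical pi_zero_morph := PiConst zero.
Canonical pi_one_morph := PiConst one.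

Lemma pi_opp : {morph \pi : u / oppp u >-> opp u}.
Proof.
move=> u; unlock opp; apply/eqP/piP; have [N eN] := push_repr u.
set u' := repr _ in eN *; exists (maxn N (maxn (tag u) (tag u'))) => m.
by rewrite !geq_max => /and3P[Nm um um']; rewrite !pushN // eN.
Qed.
Canonical pi_opp_morph := PiMorph1 pi_opp.

Lemma pi_add : {morph \pi : u v / addp u v >-> add u v}.
Proof.
move=> u v; unlock add; apply/eqP/piP.
have [M eM] := push_repr u; have [N eN] := push_repr v.
set u' := repr _ in eM *; set v' := repr _ in eN *.
exists (maxn (maxn M N) (maxn (maxn (tag u) (tag v)) (maxn (tag u') (tag v')))).
move=> m; rewrite geq_max (geq_max m M) => /andP[/andP[Mm Nm]].
by rewrite geq_max => /andP[uv uv']; rewrite !pushD // eM // eN.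
Qed.
Canonical pi_add_morph := PiMorph2 pi_add.

Lemma pi_mul : {morph \pi : u v / mulp u v >-> mul u v}.
Proof.
move=> u v; unlock mul; apply/eqP/piP.
have [M eM] := push_repr u; have [N eN] := push_repr v.
set u' := repr _ in eM *; set v' := repr _ in eN *.
exists (maxn (maxn M N) (maxn (maxn (tag u) (tag v)) (maxn (tag u') (tag v')))).
move=> m; rewrite geq_max (geq_max m M) => /andP[/andP[Mm Nm]].
by rewrite geq_max => /andP[uv uv']; rewrite !pushM // eM // eN.
Qed.
Canonical pi_mul_morph := PiMorph2 pi_mul.

Lemma tag_addp u v : tag (addp u v) = maxn (tag u) (tag v). Proof. by []. Qed.
Lemma tag_mulp u v : tag (mulp u v) = maxn (tag u) (tag v). Proof. by []. Qed.
Lemma tag_oppp u : tag (oppp u) = tag u. Proof. by []. Qed.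
Lemma tag_zerop : tag zerop = 0%N. Proof. by []. Qed.
Lemma tag_onep : tag onep = 0%N. Proof. by []. Qed.
Let tagE := (tag_addp, tag_mulp, tag_oppp, tag_zerop, tag_onep).
Let pushE := (pushD, pushM, pushN, push0, push1).

Lemma eq_large u v w a b :
  (forall m, (tag u <= m) && (tag v <= m) && (tag w <= m) ->
    push a m = push b m) -> a = b %[mod type].
Proof.
move=> e; apply/eqP/piP; exists (maxn (maxn (tag u) (tag v)) (tag w)) => m.
by rewrite !geq_max => /e.
Qed.

Local Ltac large u v w :=
  apply: (@eq_large u v w) => m /andP[/andP[? ?] ?];
  rewrite ?pushE ?tagE ?geq_max ?tagE ?geq_max; try by repeat (apply/andP; split).

Lemma addA : associative add.
Proof.
elim/quotW=> u; elim/quotW=> v; elim/quotW=> w; rewrite !piE.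
by large u v w; rewrite addrA.
Qed.

Lemma addC : commutative add.
Proof.
by elim/quotW=> u; elim/quotW=> v; rewrite !piE; large u v v; rewrite addrC.
Qed.

Lemma add0l : left_id zero add.
Proof. by elim/quotW=> u; rewrite !piE; large u u u; rewrite add0r. Qed.

Lemma addNl : left_inverse zero opp add.
Proof. by elim/quotW=> u; rewrite !piE; large u u u; rewrite addNr. Qed.

Lemma mulA : associative mul.
Proof.
elim/quotW=> u; elim/quotW=> v; elim/quotW=> w; rewrite !piE.
by large u v w; rewrite mulrA.
Qed.

Lemma mul1l : left_id one mul.
Proof. by elim/quotW=> u; rewrite !piE; large u u u; rewrite mul1r. Qed.

Lemma mul1r : right_id one mul.
Proof. by elim/quotW=> u; rewrite !piE; large u u u; rewrite mulr1. Qed.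

Lemma mulDl : left_distributive mul add.
Proof.
elim/quotW=> u; elim/quotW=> v; elim/quotW=> w; rewrite !piE.
by large u v w; rewrite mulrDl.
Qed.

Lemma mulDr : right_distributive mul add.
Proof.
elim/quotW=> u; elim/quotW=> v; elim/quotW=> w; rewrite !piE.
by large u v w; rewrite mulrDr.
Qed.

HB.instance Definition _ := GRing.isZmodule.Build type addA addC add0l addNl.
HB.instance Definition _ :=
  GRing.Zmodule_isPzRing.Build type mulA mul1l mul1r mulDl mulDr.

Definition inj k (x : S k) : type := \pi_type (mk x : pre).

Lemma inj_is_zmod_morphism k : zmod_morphism (@inj k).
Proof.
move=> x y; rewrite /inj; rewrite -[RHS]/(add _ (opp _)) -pi_opp -pi_add.
apply/eqP/piP; exists k => m km.
rewrite pushD ?pushN ?tagE ?geq_max ?km //=.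
rewrite -(subnK km); elim: (m - k)%N => [|d IH].
  by rewrite add0n; rewrite !(push_tag (mk _)).
by rewrite addSn !pushS ?leq_addl // IH rmorphB.
Qed.

Lemma inj_is_monoid_morphism k : monoid_morphism (@inj k).
Proof.
split=> [|x y]; rewrite /inj.
  rewrite -[RHS]/one piE; apply/eqP/piP; exists k => m km.
  rewrite push1 -(subnK km); elim: (m - k)%N => [|d IH].
    by rewrite add0n (push_tag (mk _)).
  by rewrite addSn pushS ?leq_addl // IH rmorph1.
rewrite -[RHS]/(mul _ _) -pi_mul.
apply/eqP/piP; exists k => m km; rewrite pushM ?geq_max ?km //=.
rewrite -(subnK km); elim: (m - k)%N => [|d IH].
  by rewrite add0n; rewrite !(push_tag (mk _)).
by rewrite addSn !pushS ?leq_addl // IH rmorphM.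
Qed.

HB.instance Definition _ k :=
  GRing.isZmodMorphism.Build (S k) type (@inj k) (@inj_is_zmod_morphism k).
HB.instance Definition _ k :=
  GRing.isMonoidMorphism.Build (S k) type (@inj k) (@inj_is_monoid_morphism k).

Lemma inj_step k (x : S k) : inj (f k x) = inj x.
Proof.
apply/eqP/piP; exists k.+1 => m km.
have e : push (mk (f k x)) k.+1 = push (mk x) k.+1.
  by rewrite (push_tag (mk (f k x))) (@pushS (mk x)) // (push_tag (mk x)).
exact: (@push_le (mk (f k x)) (mk x) _ _ (leqnn _) (leqnSn _) km e).
Qed.

Lemma inj_surj (a : type) : exists k (x : S k), a = inj x.
Proof. by elim/quotW: a => -[k x]; exists k, x. Qed.

Lemma inj_eqP k l (x : S k) (y : S l) : inj x = inj y <->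
  exists2 m, maxn k l <= m & push (mk x) m = push (mk y) m.
Proof.
by split=> [/eqP|e]; [rewrite eqmodE => /asboolP | apply/eqmodP/asboolP].
Qed.

End DirectLimit.
End DirectLimit.
HB.export DirectLimit.

Notation dirlim := DirectLimit.type.

Section MatricialClosure.
Variables (n : nat) (R : pzRingType).

Lemma sum_expn k : (\sum_(i < n) n ^ k = n ^ k.+1)%N.
Proof. by rewrite sum_nat_const card_ord expnS. Qed.

(* mxdiag orders its indices block by block, so the cast, which keeps the
   values of the indices, is the identification by block matrices. *)
Definition blockdiag k (A : 'M[R]_(n ^ k)) : 'M[R]_(n ^ k.+1) :=
  castmx (sum_expn k, sum_expn k) (\mxdiag_(i < n) A).

Lemma blockdiag_is_zmod_morphism k : zmod_morphism (@blockdiag k).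
Proof.
by move=> A B; rewrite /blockdiag mxdiagB; case: _ / (sum_expn k).
Qed.

Lemma blockdiag_is_monoid_morphism k : monoid_morphism (@blockdiag k).
Proof.
rewrite /blockdiag; case: _ / (sum_expn k); split=> [|A B].
  exact: mxdiagZ.
rewrite !castmx_id [X in _ = X]mul_mxdiag_mxblock; apply/eq_mxblock => i j.
by case: eqVneq => _; rewrite ?conform_mx_id ?mulmx0.
Qed.

HB.instance Definition _ k := GRing.isZmodMorphism.Build
  'M[R]_(n ^ k) 'M[R]_(n ^ k.+1) (@blockdiag k) (@blockdiag_is_zmod_morphism k).
HB.instance Definition _ k := GRing.isMonoidMorphism.Build
  'M[R]_(n ^ k) 'M[R]_(n ^ k.+1) (@blockdiag k)
  (@blockdiag_is_monoid_morphism k).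

Definition matricial_closure : pzRingType :=
  dirlim (S := fun k => 'M[R]_(n ^ k)) (fun k => @blockdiag k).

End MatricialClosure.

(* Main.v *)
Require Import Defs.
From mathcomp Require Import all_boot all_order all_algebra.

(** Semiprimeness passes from [R] to a matrix ring entry by entry, since the
    [(i, j)] entry of [A *m (x *: delta_mx j i) *m A] is [A i j * x * A i j].
    It passes to a direct limit with injective transition maps because each
    ring of the system then embeds in the limit, and an element [a] of the limit
    comes from some stage, where the [x] of that stage suffice to show
    [a = 0]. *)

Import GRing.Theory.

Section Semiprime.
Local Open Scope ring_scope.

Lemma semiprime_matrix (R : pzRingType) (m : nat) :
  semiprime_ring R -> semiprime_ring 'M[R]_m.
Proof.
move=> sR A sA; apply/matrixP => i j; rewrite mxE; apply: sR => x.
have : (A *m (x *: delta_mx j i) *m A) i j = 0.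
  by have /matrixP/(_ i j) := sA (x *: delta_mx j i); rewrite [RHS]mxE.
(* [delta_mx j i] leaves only the term [k = i] of the outer sum and [l = j] of the inner one. *)
move=> <-; rewrite mxE (bigD1 i) //= big1 => [|k ki].
  rewrite addr0 mxE (bigD1 j) //= big1 => [|l lj].
    by rewrite addr0 !mxE !eqxx mulr1.
  by rewrite !mxE (negbTE lj) !mulr0.
by rewrite mxE big1 ?mul0r // => l _; rewrite !mxE (negbTE ki) andbF !mulr0.
Qed.

Section DirectLimit.
Variables (S : nat -> pzRingType) (f : forall k, {rmorphism S k -> S k.+1}).
Hypothesis f_inj : forall k, injective (f k).

(** Elements equal in the limit already agree at some stage [m >= k]; injectivity of each [f] brings
    this back down to stage [k]. *)
Lemma dirlim_inj_injective k : injective (@DirectLimit.inj S f k).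
Proof.
move=> x y /DirectLimit.inj_eqP[m]; rewrite maxnn => /subnK <-.
elim: (m - k)%N => [|d IH].
  by rewrite add0n (DirectLimit.push_tag f (Tagged S x))
    (DirectLimit.push_tag f (Tagged S y)).
by rewrite addSn !DirectLimit.pushS ?leq_addl // => /f_inj.
Qed.

Lemma semiprime_dirlim :
  (forall k, semiprime_ring (S k)) -> semiprime_ring (dirlim f).
Proof.
move=> sS a sa; have [k [x ax]] := DirectLimit.inj_surj a.
rewrite {a}ax in sa *; rewrite (sS k x) ?rmorph0 // => y.
(* In the limit, the identity is [sa] at the image of [y]. *)
apply: dirlim_inj_injective.
by rewrite !rmorphM rmorph0 sa.
Qed.

End DirectLimit.

(** Since [0 < n], there is a diagonal block of index 0, which recovers the matrix. *)
Lemma blockdiag_inj (n : nat) (R : pzRingType) (k : nat) :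
  (0 < n)%N -> injective (@blockdiag n R k).
Proof.
move=> n_gt0 A B /(can_inj (castmxK _ _)) /eq_mxdiagP.
by move=> /(_ (Ordinal n_gt0)).
Qed.

End Semiprime.

Theorem proposition29 (n : nat) (R : pzRingType) :
  0 < n -> semiprime_ring R -> semiprime_ring (matricial_closure n R).
Proof.
move=> n_gt0 sR; apply: semiprime_dirlim => k; first exact: blockdiag_inj.
exact: semiprime_matrix.
Qed.
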